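(* The undirected graphs $X_f$ and $X_g$ associated to the fields $F_3[x]/(x^2+x+2)$ and $F_3[x]/(x^2+2x+2)$, i.e. with $f=x^2+x+2$ and $g=x^2+2x+2$ in $F_3[x]$, are isomorphic.
   Context: Let $p$ be a prime, $F_p$ the field with $p$ elements, $f\in F_p[x]$ irreducible of degree $k$, and $K_f=F_p[x]/(f)$; the class of $x$ in $K_f$ is again denoted $x$. Let $S=\{x,x^p,\dots,x^{p^{k-1}}\}\subset K_f$. The undirected multigraph $X_f$ has vertex set $K_f$ and the following edges. For all $y,z\in K_f$ and $s\in S$ with $z-y=s$ there is one (additive) edge between $y$ and $z$, for each such ordered pair $(y,z)$ and each $s$. For all $y,z\in K_f\setminus\{0\}$ and $s\in S$ with $zy^{-1}=s$ there is one (multiplicative) edge between $y$ and $z$, again for each such ordered pair and each $s$. An isomorphism of such graphs is a bijection $\phi$ between the vertex sets such that for all vertices $u,v$ the number of edges joining $u$ and $v$ equals the number of edges joining $\phi(u)$ and $\phi(v)$. *)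

(* Defs.v *)
From mathcomp Require Import all_boot all_order all_algebra all_field.

Set Implicit Arguments.
Unset Strict Implicit.
Unset Printing Implicit Defensive.

Import GRing.Theory.
Local Open Scope ring_scope.

(* Finite multigraphs, loops and multiple edges allowed.  The pair [mg_ends e] *)
(* only records the ends of [e]: [mg_mult] ignores its order, so that the      *)
(* graphs are undirected, and a loop counts once.                              *)
Record multigraph := Multigraph {
  mg_vertex : finType;
  mg_edge : finType;
  mg_ends : mg_edge -> mg_vertex * mg_vertex
}.

Definition mg_mult (G : multigraph) (u v : mg_vertex G) : nat :=
  #|[set e : mg_edge G | (mg_ends e == (u, v)) || (mg_ends e == (v, u))]|.

Definition mg_isomorphic (G H : multigraph) : Prop :=
  exists phi : mg_vertex G -> mg_vertex H,
    bijective phi /\ forall u v, mg_mult u v = mg_mult (phi u) (phi v).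

(* Below p is a prime; the quotient construction asks for the irreducible      *)
(* polynomial to be normalized to be monic.                                    *)
Definition Kf (p : nat) (f : {poly 'F_p}) (fI : monic_irreducible_poly f) :
  finFieldType := {poly %/ f with fI}.

Definition conjX (p : nat) (f : {poly 'F_p}) (fI : monic_irreducible_poly f) :
    {set Kf fI} :=
  [set ('qX : Kf fI) ^+ (p ^ i)%N | i : 'I_(size f).-1].

(* An edge is indexed by a triple ((y, z), s).                                 *)
Definition add_edge (p : nat) (f : {poly 'F_p}) (fI : monic_irreducible_poly f)
    : pred (Kf fI * Kf fI * Kf fI) :=
  fun t => let: (y, z, s) := t in (s \in conjX fI) && (z - y == s).

Definition mul_edge (p : nat) (f : {poly 'F_p}) (fI : monic_irreducible_poly f)
    : pred (Kf fI * Kf fI * Kf fI) :=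
  fun t => let: (y, z, s) := t in
    [&& y != 0, z != 0, s \in conjX fI & z * y^-1 == s].

Definition Xgraph (p : nat) (f : {poly 'F_p}) (fI : monic_irreducible_poly f) :
    multigraph :=
  @Multigraph (Kf fI) ({t | add_edge (fI := fI) t} + {t | mul_edge (fI := fI) t})%type
    (fun e => match e with inl t => (val t).1 | inr t => (val t).1 end).
Arguments Xgraph {p} f fI.

Definition f3 : {poly 'F_3} := 'X^2 + 'X + 2%:P.
Definition g3 : {poly 'F_3} := 'X^2 + 2 *: 'X + 2%:P.

Lemma quadratic_monic_irreducible (b c : 'F_3) :
  [forall x : 'F_3, x ^+ 2 + b * x + c != 0] ->
  monic_irreducible_poly ('X^2 + b *: 'X + c%:P).
Proof.
move=> /forallP nr.
have lt : (size (b *: 'X + c%:P)%R < size ('X^2 : {poly 'F_3})%R)%N.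
  rewrite size_polyXn (leq_ltn_trans (size_polyD _ _)) // gtn_max.
  rewrite (leq_ltn_trans (size_scale_leq _ _)) ?size_polyX //.
  by rewrite (leq_ltn_trans (size_polyC_leq1 _)).
rewrite -addrA; split; last by rewrite monicE lead_coefDl // lead_coefXn.
apply: cubic_irreducible => [|x]; first by rewrite size_polyDl // size_polyXn.
by rewrite /root !hornerE nr.
Qed.

Lemma f3_irreducible : monic_irreducible_poly f3.
Proof.
rewrite /f3 -[X in _ + X + _]scale1r; apply: quadratic_monic_irreducible.
by apply/forallP; case=> [[|[|[|m]]] ltm].
Qed.

Lemma g3_irreducible : monic_irreducible_poly g3.
Proof.
apply: quadratic_monic_irreducible.
by apply/forallP; case=> [[|[|[|m]]] ltm].
Qed.

(* Main.v *)
(** In characteristic 3 we have [g = f \Po - 'X] and [f * g = 'X^4 + 1].  Hence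
    [x |-> - x] induces a field isomorphism [phi : K_f -> K_g].  Writing [y] for the
    class of ['X] in [K_g], we have [y ^+ 4 = - 1], so [- y] and [- y ^+ 3], the
    images of the generators of [X_f], are the opposites of [y] and [y ^+ 3], and
    also their inverses, in the other order.  Thus [phi] carries additive edges to
    additive edges and multiplicative edges to multiplicative edges, at the cost of
    exchanging the ends of every edge, which an undirected graph does not see. *)

From HB Require Import structures.
From mathcomp Require Import all_boot all_order all_algebra all_field ring.
Require Import Defs.

Set Implicit Arguments.
Unset Strict Implicit.
Unset Printing Implicit Defensive.

Import GRing.Theory.
Local Open Scope ring_scope.

Section Projection.
Variables (p : nat) (f : {poly 'F_p}) (fI : monic_irreducible_poly f).

(** Naming [in_qpoly f] with the field [Kf fI] as codomain lets it carry a ring morphism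
    structure. *)
Definition qproj (a : {poly 'F_p}) : Kf fI := in_qpoly f a.

Lemma qproj_is_zmod_morphism : zmod_morphism qproj.
Proof. by move=> a b; rewrite /qproj raddfB. Qed.

Lemma qproj_is_monoid_morphism : monoid_morphism qproj.
Proof. by split=> [|a b]; rewrite /qproj (in_qpoly1, in_qpolyM). Qed.

HB.instance Definition _ := GRing.isZmodMorphism.Build {poly 'F_p} (Kf fI) qproj
  qproj_is_zmod_morphism.
HB.instance Definition _ := GRing.isMonoidMorphism.Build {poly 'F_p} (Kf fI) qproj
  qproj_is_monoid_morphism.

Lemma qproj_val (u : Kf fI) : qproj (val u) = u.
Proof. exact: val_inj (in_qpoly_small (size_mk_monic u)). Qed.

Lemma qproj_modulus : qproj f = 0.
Proof.
by apply: val_inj; rewrite /= mk_monicE // Pdiv.RingMonic.rmodpp // fI.2.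
Qed.

Lemma qprojX : qproj 'X = 'qX.
Proof. by []. Qed.

Lemma val_qproj a : a = a %/ f * f + val (qproj a).
Proof.
rewrite /= mk_monicE // -Pdiv.IdomainMonic.modpE ?fI.2 //; exact: divp_eq.
Qed.

End Projection.

(** Universal property of the quotient: substituting [r] for ['X] sends multiples of [f] to 0. The
    map is defined on the canonical representative [val u], and [hE] shows that any representative
    gives the same value. *)
Lemma subst_rmorphism p (f g r : {poly 'F_p}) (fI : monic_irreducible_poly f)
    (gI : monic_irreducible_poly g) :
  qproj gI (f \Po r) = 0 ->
  exists phi : {rmorphism Kf fI -> Kf gI},
    forall a, phi (qproj fI a) = qproj gI (a \Po r).
Proof.
move=> fr0; pose h (u : Kf fI) : Kf gI := qproj gI (val u \Po r).
have hE a : h (qproj fI a) = qproj gI (a \Po r).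
  rewrite [in RHS](val_qproj fI a) comp_polyD comp_polyM rmorphD rmorphM /= fr0.
  by rewrite mulr0 add0r.
have hB : zmod_morphism h.
  move=> u v; rewrite -[u]qproj_val -[v]qproj_val -rmorphB !hE.
  by rewrite comp_polyB rmorphB.
have hM : monoid_morphism h.
  split=> [|u v]; first by rewrite -(rmorph1 (qproj fI)) hE comp_polyC rmorph1.
  rewrite -[u]qproj_val -[v]qproj_val -rmorphM !hE.
  by rewrite comp_polyM rmorphM.
pose hA := GRing.isZmodMorphism.Build _ _ h hB.
pose hMM := GRing.isMonoidMorphism.Build _ _ h hM.
pose phi : {rmorphism Kf fI -> Kf gI} := HB.pack h hA hMM.
by exists phi.
Qed.

Section Reversal.
Variables (p : nat) (f g : {poly 'F_p}) (fI : monic_irreducible_poly f).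
Variables (gI : monic_irreducible_poly g) (phi : {rmorphism Kf fI -> Kf gI}).
Hypothesis phiN : forall s, s \in conjX fI -> - phi s \in conjX gI.
Hypothesis phiV : forall s, s \in conjX fI -> (phi s)^-1 \in conjX gI.

Lemma add_edge_reversal t : add_edge (fI := fI) t ->
  add_edge (fI := gI) (phi t.1.2, phi t.1.1, - phi t.2).
Proof.
case: t => [[y z] s] /= /andP[sS /eqP zy].
by rewrite phiN // -zy rmorphB opprB eqxx.
Qed.

Lemma mul_edge_reversal t : mul_edge (fI := fI) t ->
  mul_edge (fI := gI) (phi t.1.2, phi t.1.1, (phi t.2)^-1).
Proof.
case: t => [[y z] s] /= /and4P[y0 z0 sS /eqP zy].
by rewrite !fmorph_eq0 y0 z0 phiV // -zy rmorphM fmorphV invfM invrK mulrC eqxx.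
Qed.

Definition edge_reversal (e : mg_edge (Xgraph f fI)) : mg_edge (Xgraph g gI) :=
  match e with
  | inl t => inl (exist (add_edge (fI := gI)) _ (add_edge_reversal (valP t)))
  | inr t => inr (exist (mul_edge (fI := gI)) _ (mul_edge_reversal (valP t)))
  end.

Lemma edge_reversal_inj : injective edge_reversal.
Proof.
move=> e e' eq_ee'.
(* Passing to the underlying triples avoids equalities of dependent pairs; [eq_ee'] itself then only
   refutes the mixed additive/multiplicative cases. *)
have /eqP : match edge_reversal e with inl t => val t | inr t => val t end
          = match edge_reversal e' with inl t => val t | inr t => val t end.
  by rewrite eq_ee'.
case: e e' eq_ee' => [[[[y z] s] t]|[[[y z] s] t]]
  [[[[y' z'] s'] t']|[[[y' z'] s'] t']] //= _; rewrite !xpair_eqE.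
  rewrite eqr_opp !(inj_eq (fmorph_inj phi)).
  move=> /andP[/andP[/eqP ez /eqP ey] /eqP es].
  by congr inl; apply: val_inj; rewrite /= ez ey es.
rewrite (inj_eq invr_inj) !(inj_eq (fmorph_inj phi)).
move=> /andP[/andP[/eqP ez /eqP ey] /eqP es].
by congr inr; apply: val_inj; rewrite /= ez ey es.
Qed.

(** [edge_reversal] injects the edges joining [u] and [v] into those joining their images. The
    opposite inequality will come from the inverse morphism, so surjectivity on edges is never
    proved. *)
Lemma leq_mult_reversal (u v : Kf fI) :
  (mg_mult (G := Xgraph f fI) u v <= mg_mult (G := Xgraph g gI) (phi u) (phi v))%N.
Proof.
rewrite /mg_mult -(card_imset _ edge_reversal_inj) subset_leq_card //.
apply/subsetP=> _ /imsetP[e + ->]; rewrite !inE.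
by case: e => [[[[y z] s] t]|[[[y z] s] t]] /= /orP[] /eqP[-> ->];
  rewrite eqxx ?orbT.
Qed.

End Reversal.

Lemma polyF3_natr3 : 3%:R = 0 :> {poly 'F_3}.
Proof. by rewrite -polyC_natr (_ : 3%:R = 0 :> 'F_3) //; apply: val_inj. Qed.

Lemma mulf3g3 : f3 * g3 = 'X^4 + 1.
Proof.
rewrite /f3 /g3 -!mul_polyC.
have -> : 2%:P = 2%:R :> {poly 'F_3} by rewrite -polyC_natr.
(* [ring] does not use the characteristic, so the multiple of 3 is split off by hand. *)
have -> : ('X^2 + 'X + 2%:R) * ('X^2 + 2%:R * 'X + 2%:R) =
    'X^4 + 1 + 3%:R * ('X^3 + 2%:R * 'X^2 + 2%:R * 'X + 1) :> {poly 'F_3}.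
  by ring.
by rewrite polyF3_natr3 mul0r addr0.
Qed.

Lemma f3_compN : f3 \Po - 'X = g3.
Proof.
rewrite /f3 /g3 !comp_polyD comp_polyC comp_polyX rmorphXn /= comp_polyX sqrrN.
rewrite -mul_polyC.
have -> : 2%:P = 2%:R :> {poly 'F_3} by rewrite -polyC_natr.
have -> : - 'X = 2%:R * 'X - 3%:R * 'X :> {poly 'F_3} by ring.
by rewrite polyF3_natr3 mul0r subr0.
Qed.

Lemma g3_compN : g3 \Po - 'X = f3.
Proof.
by rewrite -f3_compN -comp_polyA raddfN /= comp_polyX opprK comp_polyXr.
Qed.

Lemma conjX_quadratic p (f : {poly 'F_p}) (fI : monic_irreducible_poly f) :
  size f = 3%N -> conjX fI = [set 'qX; 'qX ^+ p].
Proof.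
move=> szf; apply/setP=> s; rewrite !inE; apply/imsetP/orP.
  rewrite szf => -[[[|[|i]] //= lti] _ ->]; [left|right];
    by rewrite ?expn0 ?expn1 ?expr1.
rewrite szf /= => -[/eqP->|/eqP->].
  by exists ord0 => //; rewrite expn0 expr1.
by exists ord_max => //; rewrite expn1.
Qed.

Lemma size_f3 : size f3 = 3%N.
Proof.
rewrite /f3 -addrA size_polyDl size_polyXn // (leq_ltn_trans (size_polyD _ _)) //.
by rewrite size_polyX size_polyC.
Qed.

Lemma size_g3 : size g3 = 3%N.
Proof. by rewrite -f3_compN size_comp_poly2 ?size_f3 // size_polyN size_polyX. Qed.

Lemma invr_root4N1 (F : fieldType) (x : F) : x ^+ 4 = -1 -> x^-1 = - x ^+ 3.
Proof.
move=> x4; have x_neq0 : x != 0.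
  by apply/eqP => x0; move/eqP: x4; rewrite x0 expr0n eq_sym oppr_eq0 oner_eq0.
by apply: (mulfI x_neq0); rewrite mulfV // mulrN -exprS x4 opprK.
Qed.

(** Keeping [f] and [g] general makes this apply both to the isomorphism and to its inverse. *)
Lemma leq_mult_compN (f g : {poly 'F_3}) (fI : monic_irreducible_poly f)
    (gI : monic_irreducible_poly g) (phi : {rmorphism Kf fI -> Kf gI}) :
  size f = 3%N -> size g = 3%N -> qproj gI ('X^4 + 1) = 0 ->
  (forall a, phi (qproj fI a) = qproj gI (a \Po - 'X)) ->
  forall u v : Kf fI,
  (mg_mult (G := Xgraph f fI) u v <= mg_mult (G := Xgraph g gI) (phi u) (phi v))%N.
Proof.
move=> szf szg X4 phiE; have phiX : phi 'qX = - 'qX.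
  by rewrite -qprojX phiE comp_polyX rmorphN.
have X4N : ('qX : Kf gI) ^+ 4 = -1.
  by apply/eqP; rewrite -addr_eq0 -[X in _ == X]X4 rmorphD rmorphXn rmorph1.
have VN : ('qX : Kf gI)^-1 = - 'qX ^+ 3 := invr_root4N1 X4N.
have N3 : (- 'qX) ^+ 3 = - 'qX ^+ 3 :> Kf gI.
  by rewrite exprNn -signr_odd expr1 mulN1r.
(* With [y] the generator of [Kf gI], the four cases are [-(-y) = y], [-(-y^3) = y^3],
   [(-y)^-1 = y^3] and [(-y^3)^-1 = y]. *)
apply: leq_mult_reversal => s; rewrite !conjX_quadratic // !inE => /orP[]/eqP->.
- by rewrite phiX opprK eqxx.
- by rewrite rmorphXn /= phiX N3 opprK eqxx orbT.
- by rewrite phiX invrN VN opprK eqxx orbT.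
- by rewrite rmorphXn /= phiX N3 -VN invrK eqxx.
Qed.

Theorem proposition3 :
  mg_isomorphic (Xgraph f3 f3_irreducible) (Xgraph g3 g3_irreducible).
Proof.
have [phi phiE] : exists phi : {rmorphism Kf f3_irreducible -> Kf g3_irreducible},
    forall a, phi (qproj _ a) = qproj _ (a \Po - 'X).
  by apply: subst_rmorphism; rewrite f3_compN qproj_modulus.
have [psi psiE] : exists psi : {rmorphism Kf g3_irreducible -> Kf f3_irreducible},
    forall a, psi (qproj _ a) = qproj _ (a \Po - 'X).
  by apply: subst_rmorphism; rewrite g3_compN qproj_modulus.
have NXK (a : {poly 'F_3}) : (a \Po - 'X) \Po - 'X = a.
  by rewrite -comp_polyA raddfN /= comp_polyX opprK comp_polyXr.
have phiK : cancel phi psi by move=> u; rewrite -[u]qproj_val phiE psiE NXK.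
have psiK : cancel psi phi by move=> u; rewrite -[u]qproj_val psiE phiE NXK.
exists phi; split; first by exists psi.
move=> u v; apply/eqP; rewrite eqn_leq; apply/andP; split.
  apply: leq_mult_compN phiE u v; rewrite ?size_f3 ?size_g3 //.
  by rewrite -mulf3g3 rmorphM /= qproj_modulus mulr0.
(* Only the right-hand [u] and [v] are rewritten, which gives the inequality for [psi] at the
   vertices [phi u] and [phi v]. *)
rewrite -{2}[u]phiK -{2}[v]phiK.
apply: leq_mult_compN psiE _ _; rewrite ?size_f3 ?size_g3 //.
by rewrite -mulf3g3 rmorphM /= qproj_modulus mul0r.
Qed.
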